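(* Let $N$ be a finite set with $N=A\cup B$, $A\cap B=\emptyset$. Consider $f:\mathcal{P}(N)\to\mathbb{R}$ of the form $$f(S)=g(A\cap S)\,h(B\cap S),\qquad S\subseteq N,$$ where $g:\mathcal{P}(A)\to\mathbb{R}$ and $h:\mathcal{P}(B)\to\mathbb{R}$. Suppose that $f,g,h$ are standardized supermodular functions. Then $f$ is skeletal if and only if $g$ and $h$ are skeletal.
   Context: For a finite set $M$, $\mathcal{P}(M)$ is its power set. A function $f:\mathcal{P}(M)\to\mathbb{R}$ is supermodular if $f(E\cup F)+f(E\cap F)\ge f(E)+f(F)$ for all $E,F\subseteq M$, and standardized if moreover $f(S)=0$ for all $|S|\le 1$. $\mathcal{K}_\ell(M)$ is the (pointed polyhedral) cone of standardized supermodular functions on $\mathcal{P}(M)$. A standardized supermodular function $f$ is called skeletal if it is an extreme ray of $\mathcal{K}_\ell(M)$, i.e. $f\neq0$ and $\{cf\mid c\ge0\}$ is an extreme ray of $\mathcal{K}_\ell(M)$. *)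

(* Defs.v *)
From mathcomp Require Import all_boot all_order all_algebra.
From mathcomp Require Import boolp classical_sets functions reals.

Set Implicit Arguments.
Unset Strict Implicit.
Unset Printing Implicit Defensive.

Import Order.TTheory GRing.Theory Num.Theory.
Local Open Scope ring_scope.

Section Rays.
Variables (R : realType) (V : lmodType R).

Definition ray (v : V) : set V := [set c *: v | c in [set c : R | 0 <= c]]%classic.

(* An extreme ray of a convex cone K is a half-line in K issued from the origin
   that is a face: a sum of two elements of K lies on the half-line only if both
   summands do. *)
Definition extreme_ray (K r : set V) : Prop :=
  [/\ exists2 v : V, v != 0 & r = ray v,
      (r `<=` K)%classic
    & forall x y : V, K x -> K y -> r (x + y) -> r x /\ r y].

End Rays.

Section Supermodular.
Variables (R : realType) (M : finType).

(* R^o is R seen as a module over itself; it makes {set M} -> R^o a vector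
   space over R for the pointwise operations. *)
Implicit Types f : {set M} -> R^o.

Definition supermodular f : Prop :=
  forall E F : {set M}, f E + f F <= f (E :|: F) + f (E :&: F).

Definition std_supermodular f : Prop :=
  supermodular f /\ forall S : {set M}, (#|S| <= 1)%N -> f S = 0.

Definition std_supermodular_cone : set ({set M} -> R^o) :=
  [set f | std_supermodular f]%classic.

Definition skeletal f : Prop :=
  f != 0 /\ extreme_ray std_supermodular_cone (ray f).

End Supermodular.

(* A :&: S as a subset of the finite type {x | x \in A}, that is, as an element
   of the power set of A. *)
Definition trace (N : finType) (A S : {set N}) : {set {x : N | x \in A}} :=
  val @^-1: S.

(* Main.v *)
Require Import Defs.
From mathcomp Require Import all_boot all_order all_algebra.
From mathcomp Require Import reals.
From mathcomp Require Import boolp functions lra.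

Set Implicit Arguments.
Unset Strict Implicit.
Unset Printing Implicit Defensive.

(** A standardized supermodular function is nonnegative and monotone, hence
    [g \otimes h] is supermodular whenever [g] and [h] are.  If [f = g \otimes h]
    is extreme, a decomposition of a multiple of [g] tensored with [h] gives one
    of [f], and evaluating at a point where [h] does not vanish brings the
    conclusion back to [g].  Conversely, if [x + y = c f] in the cone, then
    [0 <= x <= c f] makes every slice [x (S \cup _)] standardized, so extremeness
    of [h] gives [x (S \cup T) = d(S) h(T)]; symmetrically the slice at some [T0]
    with [h(T0) > 0] is a multiple of [g], whence [d] is a multiple of [g]. *)

Import Order.TTheory GRing.Theory Num.Theory.
Local Open Scope ring_scope.

Section StandardizedSupermodular.
Variables (R : realType) (M : finType).
Implicit Types (f x y : {set M} -> R^o) (S T : {set M}).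

(** Induction on the cardinality: [f] vanishes on singletons and on the empty set, so
    supermodularity for [[set a]] and [S :\ a] reads [f (S :\ a) <= f S]. *)
Lemma std_supermodular_ge0 f S : std_supermodular f -> 0 <= f S.
Proof.
move=> [fsm f0]; have [n] := ubnP #|S|; elim: n S => // n IHn S leSn.
have [/eqP S0|[a aS]] := set_0Vmem S.
  by rewrite f0 // (eqP S0) cards0.
have := fsm [set a] (S :\ a).
rewrite setD1K // (_ : [set a] :&: (S :\ a) = set0); last first.
  by apply/setP => b; rewrite !inE; case: eqP.
rewrite f0 ?cards1 // add0r (f0 set0) ?cards0 // addr0.
by apply: le_trans; apply: IHn; move: leSn; rewrite (cardsD1 a) aS.
Qed.

(** Supermodularity for the disjoint sets [S] and [T :\: S] gives [f S + f (T :\: S) <= f T], and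
    the extra term is nonnegative. *)
Lemma std_supermodular_le f S T :
  std_supermodular f -> S \subset T -> f S <= f T.
Proof.
move=> fK ST; have [fsm f0] := fK.
have := fsm S (T :\: S).
rewrite (_ : S :&: (T :\: S) = set0); last first.
  by apply/setP => b; rewrite !inE; case: (b \in S).
rewrite (f0 set0) ?cards0 // addr0.
rewrite -{3}(setIidPr ST) setID.
by apply: le_trans; rewrite lerDl std_supermodular_ge0.
Qed.

Lemma std_supermodularZ f (c : R) :
  0 <= c -> std_supermodular f -> std_supermodular (c *: f).
Proof.
move=> c0 [fsm f0]; split=> [E F|S /f0 fS].
  by rewrite /GRing.scale /= -!mulrDr ler_wpM2l.
by rewrite -[LHS]/(c * f S) fS mulr0.
Qed.

(** The cone is closed under nonnegative scaling, so it contains the ray of [f]; and [x], [y] play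
    symmetric roles, so the face condition need only be checked on [x]. *)
Lemma skeletalP f : std_supermodular f ->
  skeletal f <-> f != 0 /\
    forall x y (c : R), std_supermodular x -> std_supermodular y -> 0 <= c ->
      x + y = c *: f -> exists2 d : R, 0 <= d & x = d *: f.
Proof.
move=> fK; split=> [[f0 [_ _ fext]]|[f0 fext]]; split=> //.
  move=> x y c xK yK c0 xyE.
  have [|[d d0 <-] _] := fext x y xK yK; last by exists d.
  by exists c.
split; first by exists f.
  by move=> _ [c c0 <-]; apply: std_supermodularZ.
move=> x y xK yK [c c0 xyE]; split.
  by have [d d0 ->] := fext x y c xK yK c0 (esym xyE); exists d.
by have [|d d0 ->] := fext y x c yK xK c0; [rewrite addrC|exists d].
Qed.

End StandardizedSupermodular.

Lemma fun_neq0 (R : realType) (M : Type) (f : M -> R^o) :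
  f != 0 -> exists a, f a != 0.
Proof.
move=> f0; apply: contrapT => nf; move/eqP: f0; apply.
apply/funext => a; apply/eqP/negPn/negP => fa; apply: nf.
by exists a.
Qed.

Section Tensor.
Variables (R : realType) (N : finType) (A B : {set N}).

Definition tensor (g : {set {x : N | x \in A}} -> R^o)
    (h : {set {x : N | x \in B}} -> R^o) : {set N} -> R^o :=
  fun S => g (trace A S) * h (trace B S).

Lemma card_trace (C S : {set N}) : (#|trace C S| <= #|S|)%N.
Proof.
rewrite -(card_imset (mem (trace C S)) val_inj); apply: subset_leq_card.
by apply/subsetP => a /imsetP[b]; rewrite inE => bS ->.
Qed.

Lemma tensor_std_supermodular g h : std_supermodular g -> std_supermodular h ->
  std_supermodular (tensor g h).
Proof.
move=> gK hK; have [[gsm g0] [hsm _]] := (gK, hK).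
split=> [E F|S S1]; last by rewrite /tensor g0 ?mul0r // (leq_trans (card_trace _ _)).
rewrite /tensor /trace !preimsetU !preimsetI -!/(trace _ _).
have := gsm (trace A E) (trace A F); have := hsm (trace B E) (trace B F).
have := std_supermodular_le gK (subsetIl (trace A E) (trace A F)).
have := std_supermodular_le gK (subsetIr (trace A E) (trace A F)).
have := std_supermodular_le hK (subsetIl (trace B E) (trace B F)).
have := std_supermodular_le hK (subsetIr (trace B E) (trace B F)).
have := std_supermodular_ge0 (trace A E :&: trace A F) gK.
have := std_supermodular_ge0 (trace B E :&: trace B F) hK.
have := std_supermodular_ge0 (trace B E :|: trace B F) hK.
set gI := g (_ :&: _); set gU := g (_ :|: _).
set gE := g (trace A E); set gF := g (trace A F).
set hI := h (_ :&: _); set hU := h (_ :|: _).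
set hE := h (trace B E); set hF := h (trace B F).
move=> hU0 hI0 gI0 hF1 hE1 gF1 gE1 hS gS.
(* The four products add up exactly to [gU * hU + gI * hI - gE * hE - gF * hF]; their factors are
   nonnegative by supermodularity, monotonicity and nonnegativity. *)
have p1 : 0 <= (gU + gI - gE - gF) * hU by apply: mulr_ge0; lra.
have p2 : 0 <= (gE + gF - gI) * (hU + hI - hE - hF) by apply: mulr_ge0; lra.
have p3 : 0 <= (gE - gI) * (hF - hI) by apply: mulr_ge0; lra.
have p4 : 0 <= (gF - gI) * (hE - hI) by apply: mulr_ge0; lra.
lra.
Qed.

End Tensor.

Section Slices.
Variables (R : realType) (N : finType) (A B : {set N}).

(** When [A] and [B] partition [N], this is the inverse of [U |-> (trace A U, trace B U)], so that
    functions on subsets of [N] become functions of two variables. *)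
Definition glue (S : {set {x : N | x \in A}}) (T : {set {x : N | x \in B}}) :
  {set N} := val @: S :|: val @: T.

Lemma trace_imset (C : {set N}) (S : {set {x : N | x \in C}}) :
  trace C (val @: S) = S.
Proof. by apply/setP => a; rewrite inE mem_imset //; apply: val_inj. Qed.

Lemma trace_imset_disjoint (C D : {set N}) (S : {set {x : N | x \in C}}) :
  C :&: D = set0 -> trace D (val @: S) = set0.
Proof.
move=> CD; apply/setP => a; rewrite !inE; apply/negbTE/imsetP => -[b _ ab].
by have := in_set0 (val a); rewrite -CD inE {1}ab (valP a) (valP b).
Qed.

Lemma imset_trace (C S : {set N}) : val @: trace C S = S :&: C.
Proof.
apply/setP => a; rewrite inE; apply/imsetP/andP => [[b]|[aS aC]].
  by rewrite inE => bS ->; split => //; apply: valP.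
by exists (exist _ a aC); rewrite ?inE.
Qed.

Lemma glue_trace (U : {set N}) :
  A :|: B = setT -> glue (trace A U) (trace B U) = U.
Proof. by move=> AB; rewrite /glue !imset_trace -setIUr AB setIT. Qed.

Lemma trace_glue S T : A :&: B = set0 ->
  trace A (glue S T) = S /\ trace B (glue S T) = T.
Proof.
move=> AB; have BA : B :&: A = set0 by rewrite setIC.
rewrite /trace /glue !preimsetU -!/(trace _ _) !trace_imset.
by rewrite !trace_imset_disjoint // setU0 set0U.
Qed.

Lemma glueUr S T T' : glue S T :|: glue S T' = glue S (T :|: T').
Proof. by rewrite /glue imsetU -setUUr. Qed.

Lemma glueIr S T T' : glue S T :&: glue S T' = glue S (T :&: T').
Proof. by rewrite /glue imsetI ?setUIr // => a b _ _; apply: val_inj. Qed.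

(** For fixed [S], [glue S] preserves unions and intersections, so the slice inherits
    supermodularity. Vanishing on small [T] is not inherited, but an upper bound suffices since [x]
    is nonnegative. *)
Lemma std_supermodular_slice (x : {set N} -> R^o) S : std_supermodular x ->
  (forall T : {set {x : N | x \in B}}, (#|T| <= 1)%N -> x (glue S T) <= 0) ->
  std_supermodular (fun T => x (glue S T) : R^o).
Proof.
move=> xK xle0; split=> [E F|T T1].
  by rewrite -glueUr -glueIr; apply: xK.1.
by apply/eqP; rewrite eq_le xle0 //= std_supermodular_ge0.
Qed.

Lemma skeletal_slice (g : {set {x : N | x \in A}} -> R^o)
    (h : {set {x : N | x \in B}} -> R^o) (x y : {set N} -> R^o) (c : R) S :
  A :&: B = set0 -> std_supermodular g -> std_supermodular h -> skeletal h ->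
  std_supermodular x -> std_supermodular y -> 0 <= c ->
  x + y = c *: tensor g h ->
  exists2 d : R, 0 <= d & forall T, x (glue S T) = d * h T.
Proof.
move=> AB gK hK /(skeletalP hK)[_ hext] xK yK c0 xyE.
have xyT T : x (glue S T) + y (glue S T) = c * g S * h T.
  have [tA tB] := trace_glue S T AB.
  by rewrite -[LHS]/((x + y) _) xyE -[LHS]/(c * tensor g h _) /tensor tA tB mulrA.
(* On small [T] the two nonnegative slices sum to zero, which bounds each of them by zero. *)
have sum0 (T : {set {x : N | x \in B}}) : (#|T| <= 1)%N ->
    x (glue S T) + y (glue S T) = 0.
  by move=> T1; rewrite xyT hK.2 // mulr0.
have xS : std_supermodular (fun T => x (glue S T) : R^o).
  apply: std_supermodular_slice => // T /sum0 <-.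
  by rewrite lerDl std_supermodular_ge0.
have yS : std_supermodular (fun T => y (glue S T) : R^o).
  apply: std_supermodular_slice => // T /sum0 <-.
  by rewrite lerDr std_supermodular_ge0.
have cg0 : 0 <= c * g S by rewrite mulr_ge0 // std_supermodular_ge0.
have [|d d0 xE] := hext _ _ _ xS yS cg0; first exact/funext.
by exists d => // T; rewrite -[LHS]/((fun T => x (glue S T) : R^o) T) xE.
Qed.

End Slices.

(** Together with [tensorC], this lets the one-sided lemmas serve for either factor. *)
Lemma glueC (N : finType) (A B : {set N}) S T :
  @glue N A B S T = @glue N B A T S.
Proof. exact: setUC. Qed.

Lemma tensorC (R : realType) (N : finType) (A B : {set N})
    (g : {set {x : N | x \in A}} -> R^o) (h : {set {x : N | x \in B}} -> R^o) :
  tensor g h = tensor h g.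
Proof. by apply/funext => S; rewrite /tensor mulrC. Qed.

Section SkeletalTensor.
Variables (R : realType) (N : finType) (A B : {set N}).
Variables (g : {set {x : N | x \in A}} -> R^o).
Variables (h : {set {x : N | x \in B}} -> R^o).
Hypothesis disjAB : A :&: B = set0.
Hypotheses (gK : std_supermodular g) (hK : std_supermodular h).

Lemma tensor_glue S T : tensor g h (glue S T) = g S * h T.
Proof. by have [tA tB] := trace_glue S T disjAB; rewrite /tensor tA tB. Qed.

Lemma skeletal_tensorl : skeletal (tensor g h) -> skeletal g.
Proof.
have fK := tensor_std_supermodular gK hK.
move=> /(skeletalP fK)[f0 fext]; apply/(skeletalP gK).
(* One point [U] serves twice: [g] is nonzero at its trace on [A], and [h (trace B U)] is the factor
   cancelled at the end. *)
have [U fU] := fun_neq0 f0.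
have [gU hU] : g (trace A U) != 0 /\ h (trace B U) != 0.
  by apply/andP; rewrite -negb_or -mulf_eq0.
split=> [|x y c xK yK c0 xyE].
  by apply: contraNneq gU => ->.
have [||||d d0 xE] := fext (tensor x h) (tensor y h) c => //.
- exact: tensor_std_supermodular.
- exact: tensor_std_supermodular.
- apply/funext => V; rewrite -[RHS]/(c * (g _ * h _)) mulrA.
  by rewrite -[c * g _]/((c *: g) _) -xyE [RHS]mulrDl.
exists d => //; apply/funext => S; apply: (mulIf hU).
have [tA tB] := trace_glue S (trace B U) disjAB.
move/(congr1 (fun k => k (glue S (trace B U)))): xE.
rewrite -[X in _ = X -> _]/(d * (g _ * h _)) /tensor tA tB mulrA.
exact.
Qed.

Lemma tensor_skeletal : A :|: B = setT -> skeletal g -> skeletal h ->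
  skeletal (tensor g h).
Proof.
move=> defN gS hS; have fK := tensor_std_supermodular gK hK.
have [[g0 _] [h0 _]] := (gS, hS).
have [S0 gS0] := fun_neq0 g0; have [T0 hT0] := fun_neq0 h0.
apply/(skeletalP fK); split=> [|x y c xK yK c0 xyE].
  have : g S0 * h T0 != 0 by rewrite mulf_neq0.
  by rewrite -tensor_glue; apply: contraNneq => ->.
have disjBA : B :&: A = set0 by rewrite setIC.
have xyE' : x + y = c *: tensor h g by rewrite tensorC.
(* The slice of [x] at [T0], with the roles of [A] and [B] exchanged, is [e] times [g]; hence the
   global multiplier must be [e / h T0]. *)
have [e e0 xT0] := skeletal_slice T0 disjBA hK gK gS xK yK c0 xyE'.
exists (e / h T0); first by rewrite divr_ge0 // std_supermodular_ge0.
apply/funext => U; rewrite -{1}(glue_trace U defN).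
have [d _ xS] := skeletal_slice (trace A U) disjAB gK hK hS xK yK c0 xyE.
(* Both slices through the point [(trace A U, T0)] compute the same value of [x], so
   [d * h T0 = e * g (trace A U)]. *)
have dE : d = e * g (trace A U) / h T0.
  by apply/(canRL (mulfK hT0)); rewrite -xS glueC xT0.
by rewrite xS dE -[RHS]/(e / h T0 * (g _ * h _)) mulrA (mulrAC e).
Qed.

End SkeletalTensor.

Theorem proposition4p3 (R : realType) (N : finType) (A B : {set N})
    (defN : A :|: B = [set: N]) (disjAB : A :&: B = set0)
    (f : {set N} -> R^o)
    (g : {set {x : N | x \in A}} -> R^o)
    (h : {set {x : N | x \in B}} -> R^o)
    (defF : forall S : {set N}, f S = g (trace A S) * h (trace B S))
    (f_ssm : std_supermodular f) (g_ssm : std_supermodular g)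
    (h_ssm : std_supermodular h) :
  skeletal f <-> skeletal g /\ skeletal h.
Proof.
have -> : f = tensor g h by apply/funext.
have disjBA : B :&: A = set0 by rewrite setIC.
split=> [fS|[gS hS]]; last exact: tensor_skeletal.
split; first exact: skeletal_tensorl fS.
by move: fS; rewrite tensorC; apply: skeletal_tensorl.
Qed.
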